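(* Let $N\prec M$ be models of $T$ with $M$ countable and $\dim(M/N)=1$. Then for any distinct $a,b\in N$, $M$ is a union of fans over $N$; that is, $M=N\cup\bigcup_{d\in D}F_{abd}$ for some set $D\subseteq M-N$. Inductively, the conclusion applies to any $M'\succ M$: $M'$ is likewise the union of $N$ and a family of fans $F_{abd}$ with $d\in M'-N$.
   Context: A quasigroup $(Q,* )$ is a set with a binary operation such that for all $a,b$ there are unique $x,y$ with $a*x=b$, $y*a=b$. A $(2,q)$-variety is a variety in which every subalgebra generated by two distinct elements is isomorphic to the free algebra $F_2(V)$ on two generators and has cardinality $q$. A Mikado variety is a $(2,q)$-variety all of whose fundamental operations are binary and which has an equational base of 2-variable equations. $T$ is a strongly minimal theory in the vocabulary $\{*,R\}$ such that for every $M\models T$: (1) $(M,* )$ is a quasigroup in a Mikado variety $V$ with $|F_2(V)|=q$; (2) $R$ is the collinearity relation: $R(a,b,c)$ holds iff $a,b,c$ are distinct and $c$ lies in the subalgebra generated by $a,b$ (this $q$-element subalgebra is the line $\overline{ab}$; so $(M,R)$ is a $q$-Steiner system: any two points lie on a unique line and all lines have $q$ points); (3) there is an integer valued function $\delta$ on finite subsets of $M$ with $\delta(\emptyset)=0$, $\delta(A)\ge0$, and $\delta(C/A)\ge\delta(C/A\cup B)$ for disjoint $A,B,C$ (where $\delta(C/A)=\delta(A\cup C)-\delta(A)$), and, with $d(A)=\min\{\delta(B):A\subseteq B\subseteq M,\ B\text{ finite}\}$, $d$ is the dimension function of algebraic closure in $M$. $\dim(M/N)=1$ means $M=\mathrm{acl}(N\cup\{c\})$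 for some $c\in M-N$. Paths. Let $a\ne b$ and $d_1\notin\mathrm{acl}(a,b)$. The path $P_{abd_1}$ is the sequence $d_1,d_2,\dots$ with $a*d_{2i+1}=d_{2i+2}$ and $b*d_{2i+2}=d_{2i+3}$, continued as long as possible, stopping if the new line $\overline{d_jd_{j+1}}$ meets an earlier non-adjacent line of the path in a point other than $a,b$. Its envelope $P^e_{abd_1}$ is the union of the lines $\overline{d_id_{i+1}}$ (minus $a,b$). The lines containing $a$ (resp. $b$) are its $a$-edges (resp. $b$-edges). $P_{bad_1}$ is defined in the same way with the roles of $a$ and $b$ exchanged (starting with a $b$-line). Fans. $F^0_{abd_1}$ consists of all points on envelopes of paths $P_{abe}$ (generated by a line $\overline{ae}$) with $e$ on a $b$-edge of $P_{abd_1}$, or paths $P_{bae}$ (generated by a line $\overline{be}$) with $e$ on an $a$-edge of $P_{bad_1}$. $F^{n+1}_{abd_1}$ consists of all points on envelopes of paths $P_{abe}$ with $e$ on a $b$-edge in $F^n_{abd_1}$, or $P_{bae}$ with $e$ on an $a$-edge in $F^n_{bad_1}$. The fan is $F_{abd_1}=\bigcup_{n<\omega}F^n_{abd_1}$. *)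

(* Defs.v *)
From mathcomp Require Export all_boot all_order all_algebra.
From mathcomp Require Export boolp classical_sets functions cardinality.

Set Implicit Arguments.
Unset Strict Implicit.
Unset Printing Implicit Defensive.

Local Open Scope classical_set_scope.
Local Open Scope card_scope.

Record signature := Signature { op : Type; ar : op -> nat }.

Record algebra (S : signature) := Algebra {
  acarrier :> Type;
  aop : forall f : op S, ('I_(ar f) -> acarrier) -> acarrier }.
Arguments aop {S} a f _.

Inductive term (S : signature) (X : Type) : Type :=
| Var of X
| App (f : op S) of ('I_(ar f) -> term S X).

Fixpoint eval S (A : algebra S) X (v : X -> A) (t : term S X) : A :=
  match t with
  | Var x => v x
  | App f ts => aop A f (fun k => eval v (ts k))
  end.

Definition hom S (A B : algebra S) (h : A -> B) : Prop :=
  forall f (u : 'I_(ar f) -> A), h (aop A f u) = aop B f (fun k => h (u k)).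

Definition isomorphic S (A B : algebra S) : Prop :=
  exists h : A -> B, hom h /\ bijective h.

Inductive gen S (A : algebra S) (X : set A) : A -> Prop :=
| gen_in x of X x : gen X x
| gen_op f (u : 'I_(ar f) -> A) of (forall k, gen X (u k)) : gen X (aop A f u).

Definition gen_alg S (A : algebra S) (X : set A) : algebra S :=
  @Algebra S {x : A | gen X x}
    (fun f u => exist (gen X) (aop A f (fun k => sval (u k)))
                      (gen_op (fun k => svalP (u k)))).

(* Equational base: [V] is the class of models of the identities [E], whose
   variables range over [X]. *)
Definition has_base S X (V : algebra S -> Prop)
    (E : set (term S X * term S X)) : Prop :=
  forall A, V A <-> forall e, E e -> forall v : X -> A, eval v e.1 = eval v e.2.

Definition variety S (V : algebra S -> Prop) : Prop :=
  exists E : set (term S nat * term S nat), has_base V E.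

(* [F] is a free algebra of [V] with the two free generators [s], [t]. *)
Definition free2 S (V : algebra S -> Prop) (F : algebra S) (s t : F) : Prop :=
  V F /\ forall B : algebra S, V B -> forall x y : B,
    exists! h : F -> B, hom h /\ h s = x /\ h t = y.

Definition is_F2 S (V : algebra S -> Prop) (F : algebra S) : Prop :=
  exists s t : F, free2 V s t.

Definition card_F2 S (V : algebra S -> Prop) (q : nat) : Prop :=
  exists F, is_F2 V F /\ [set: F] #= `I_q.

Definition two_q_variety S (V : algebra S -> Prop) (q : nat) : Prop :=
  variety V /\
  forall A, V A -> forall x y : A, x <> y ->
    (exists F, is_F2 V F /\ isomorphic (gen_alg [set x; y]) F) /\
    [set: gen_alg [set x; y]] #= `I_q.

Definition mikado S (V : algebra S -> Prop) (q : nat) : Prop :=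
  [/\ two_q_variety V q,
      forall f : op S, ar f = 2%N &
      exists E : set (term S 'I_2 * term S 'I_2), has_base V E].

Record language := Language {
  lsig :> signature;
  rel_sym : Type;
  rel_ar : rel_sym -> nat }.

Record structure (L : language) := Structure {
  reduct :> algebra L;
  srel : forall r : rel_sym L, ('I_(rel_ar r) -> reduct) -> Prop }.
Arguments srel {L} s r _.

(* Formulas whose free variables are among the [n] elements of ['I_n]; under
   the quantifier, variable [ord0] is the bound one. *)
Inductive formula (L : language) : nat -> Type :=
| Bot n : formula L n
| Eq n of term L 'I_n & term L 'I_n : formula L n
| Rel n (r : rel_sym L) of ('I_(rel_ar r) -> term L 'I_n) : formula L n
| Imp n of formula L n & formula L n : formula L n
| All n of formula L n.+1 : formula L n.

Definition scons T n (x : T) (v : 'I_n -> T) : 'I_n.+1 -> T :=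
  fun k => oapp v x (unlift ord0 k).

Fixpoint sat L (M : structure L) n (phi : formula L n) : ('I_n -> M) -> Prop :=
  match phi with
  | Bot _ => fun=> False
  | Eq _ t u => fun v => eval v t = eval v u
  | Rel _ r ts => fun v => srel M r (fun k => eval v (ts k))
  | Imp _ p1 p2 => fun v => sat p1 v -> sat p2 v
  | All _ p => fun v => forall x, sat p (scons x v)
  end.

Definition theory L := set (formula L 0).

Definition models L (M : structure L) (T : theory L) : Prop :=
  forall phi, T phi -> forall v : 'I_0 -> M, sat phi v.

(* [N] is, up to the identification along [i], an elementary substructure of
   [M]; injectivity of [i] is the case of the formula x = y. *)
Definition elementary L (N M : structure L) (i : N -> M) : Prop :=
  forall n (phi : formula L n) (v : 'I_n -> N),
    sat phi v <-> sat phi (fun k => i (v k)).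

Definition definable L (M : structure L) n (phi : formula L n.+1)
    (v : 'I_n -> M) : set M := [set x | sat phi (scons x v)].

Definition strongly_minimal L (T : theory L) : Prop :=
  forall M : structure L, models M T ->
    infinite_set [set: M] /\
    forall n (phi : formula L n.+1) (v : 'I_n -> M),
      finite_set (definable phi v) \/ finite_set (~` definable phi v).

Definition acl L (M : structure L) (A : set M) : set M :=
  [set c | exists n (phi : formula L n.+1) (v : 'I_n -> M),
     [/\ forall k, A (v k), finite_set (definable phi v) & definable phi v c]].

Definition acl_basis L (M : structure L) (A B : set M) : Prop :=
  [/\ B `<=` A, forall b, B b -> ~ acl (B `\ b) b & A `<=` acl B].

Definition acl_dim L (M : structure L) (A : set M) (n : nat) : Prop :=
  exists B, acl_basis A B /\ B #= `I_n.

(* dim(M/N) = 1, with [N] identified with [range i]. *)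
Definition dim1 L (N M : structure L) (i : N -> M) : Prop :=
  exists c, ~ range i c /\ acl (range i `|` [set c]) = setT.

Inductive star_op := Star.
Inductive coll_rel := Coll.

Definition star_sig : signature := Signature (fun _ : star_op => 2%N).
Definition star_lang : language :=
  @Language star_sig coll_rel (fun=> 3%N).

Definition mul (M : algebra star_sig) (x y : M) : M :=
  aop M Star (tnth [tuple x; y]).

Definition coll (M : structure star_lang) (x y z : M) : Prop :=
  srel M Coll (tnth [tuple x; y; z]).

Definition quasigroup (M : algebra star_sig) : Prop :=
  forall a b : M, (exists! x, mul a x = b) /\ (exists! y, mul y a = b).

(* The line through [a] and [b], for [a <> b]. *)
Definition line (M : algebra star_sig) (a b : M) : set M := gen [set a; b].

(* Only the values of [delta] at finite sets matter. *)
Definition predimension M (delta : set M -> int) : Prop :=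
  [/\ delta set0 = 0%R,
      forall A, finite_set A -> (0 <= delta A)%R &
      forall A B C, finite_set A -> finite_set B -> finite_set C ->
        A `&` B = set0 -> A `&` C = set0 -> B `&` C = set0 ->
        (delta (A `|` B `|` C) - delta (A `|` B)
           <= delta (A `|` C) - delta A)%R].

(* [z] is the value at [A] of the function d associated with [delta]. *)
Definition is_d M (delta : set M -> int) (A : set M) (z : int) : Prop :=
  (exists B, [/\ finite_set B, A `<=` B & delta B = z]) /\
  (forall B, finite_set B -> A `<=` B -> (z <= delta B)%R).

Record steiner_theory (V : algebra star_sig -> Prop) (q : nat)
    (T : theory star_lang) : Prop := SteinerTheory {
  st_strongly_minimal : strongly_minimal T;
  st_mikado : mikado V q;
  st_card_F2 : card_F2 V q;
  st_variety : forall M : structure star_lang, models M T -> V M;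
  st_quasigroup : forall M : structure star_lang, models M T -> quasigroup M;
  st_collinear : forall M : structure star_lang, models M T ->
    forall a b c : M,
      coll a b c <-> [/\ a <> b, a <> c, b <> c & line a b c];
  st_delta : forall M : structure star_lang, models M T ->
    exists delta : set M -> int, predimension delta /\
      forall A : set M, finite_set A ->
        forall n : nat, is_d delta A n%:Z%R <-> acl_dim A n }.

(* [Path a b d] stands for the path P_{abd}. *)
Record path (M : Type) := Path { pa : M; pb : M; pstart : M }.

Section PathsAndFans.
Variable M : structure star_lang.
Implicit Types (P : path M) (a b d x : M).

(* P_{abd} is considered only in this case. *)
Definition legal P : Prop :=
  pa P <> pb P /\ ~ acl [set pa P; pb P] (pstart P).

(* Numbered from 0: [path_pt P j] is the point d_{j+1}, so even [j] are the
   odd indices, where one multiplies by [pa P]. *)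
Fixpoint path_pt P (j : nat) : M :=
  match j with
  | 0 => pstart P
  | j'.+1 => mul (if odd j' then pb P else pa P) (path_pt P j')
  end.

Definition path_line P (j : nat) : set M :=
  line (path_pt P j) (path_pt P j.+1).

(* The stopping condition at the [j]-th line; the line [j.-1] is adjacent. *)
Definition path_stops P (j : nat) : Prop :=
  exists2 k, (k.+1 < j)%N &
    exists x, [/\ path_line P k x, path_line P j x, x <> pa P & x <> pb P].

(* The [j]-th line belongs to the path: the path did not stop before.  The
   line at which the path stops is its last line. *)
Definition path_has P (j : nat) : Prop :=
  forall k, (k < j)%N -> ~ path_stops P k.

Definition envelope P : set M :=
  [set x | exists j, [/\ path_has P j, path_line P j x, x <> pa P & x <> pb P]].

(* The [x]-edges of [P], for [x] one of [pa P] and [pb P]. *)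
Definition edges P x : set (set M) :=
  [set l | l x /\ exists2 j, path_has P j & l = path_line P j].

Definition on_edge P x : set M := [set e | exists2 l, edges P x l & l e].

(* The paths P_{abe} with [e] in [X], and the paths P_{bae} with [e] in [Y]. *)
Definition paths_from a b (X Y : set M) : set (path M) :=
  [set P | legal P /\
     ((exists2 e, X e & P = Path a b e) \/ (exists2 e, Y e & P = Path b a e))].

(* The paths whose envelopes make up F^n_{abd}; an edge in F^n_{abd} is an
   edge of one of them. *)
Fixpoint fan_paths (n : nat) a b d : set (path M) :=
  match n with
  | 0 => paths_from a b (on_edge (Path a b d) b) (on_edge (Path b a d) a)
  | n'.+1 =>
      paths_from a b
        [set e | exists2 P, fan_paths n' a b d P & on_edge P b e]
        [set e | exists2 P, fan_paths n' b a d P & on_edge P a e]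
  end.

Definition fan_level (n : nat) a b d : set M :=
  [set x | exists2 P, fan_paths n a b d P & envelope P x].

Definition fan a b d : set M := \bigcup_n fan_level n a b d.

End PathsAndFans.

(* Main.v *)
(** The point [d] itself already lies on the fan [F_{abd}]: if [d] is outside
    [N], then the second line of [P_{abd}] is the [b]-edge through
    [e = a * d], and the first line of [P_{abe}] is the line through [a] and
    [e], which is the line through [a] and [d].  So the fans [F_{abd}] with [d]
    ranging over all of [M - N] cover [M - N].  This needs that [N] is
    algebraically closed in [M] (for the path [P_{abe}] to be legal), that
    multiplication is idempotent and that two points determine a line. *)

Require Import Defs.
From mathcomp Require Import finmap.

Set Implicit Arguments.
Unset Strict Implicit.
Unset Printing Implicit Defensive.

Local Open Scope classical_set_scope.
Local Open Scope card_scope.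

(** * Renaming of variables in terms and formulas *)

Section Renaming.
Variable L : language.

Fixpoint tren X Y (f : X -> Y) (t : term L X) : term L Y :=
  match t with
  | Var x => Var L (f x)
  | App g ts => App (fun k => tren f (ts k))
  end.

Lemma eval_tren (A : algebra L) X Y (f : X -> Y) (v : Y -> A) t :
  eval v (tren f t) = eval (v \o f) t.
Proof.
by elim: t => [x|g ts IH] //=; congr aop; apply/funext => k; exact: IH.
Qed.

(** The form a renaming takes under a quantifier: the bound variable stays fixed. *)
Definition up n m (f : 'I_n -> 'I_m) : 'I_n.+1 -> 'I_m.+1 :=
  scons ord0 (lift ord0 \o f).

Lemma scons0 T n (x : T) (v : 'I_n -> T) : scons x v ord0 = x.
Proof. by rewrite /scons unlift_none. Qed.

Lemma scons_lift T n (x : T) (v : 'I_n -> T) k : scons x v (lift ord0 k) = v k.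
Proof. by rewrite /scons liftK. Qed.

Lemma comp_scons T U n (h : T -> U) (x : T) (v : 'I_n -> T) :
  h \o scons x v = scons (h x) (h \o v).
Proof. by apply/funext => k; rewrite /scons /=; case: unlift. Qed.

Lemma scons_up T n m (f : 'I_n -> 'I_m) (x : T) (v : 'I_m -> T) :
  scons x v \o up f = scons x (v \o f).
Proof.
rewrite /up comp_scons scons0; congr scons.
by apply/funext => k /=; rewrite scons_lift.
Qed.

Fixpoint fren n (phi : formula L n) : forall m, ('I_n -> 'I_m) -> formula L m :=
  match phi with
  | Bot _ => fun m _ => Bot L m
  | Eq _ t u => fun _ f => Eq (tren f t) (tren f u)
  | Rel _ r ts => fun _ f => Rel (fun k => tren f (ts k))
  | Imp _ p1 p2 => fun _ f => Imp (fren p1 f) (fren p2 f)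
  | All _ p => fun _ f => All (fren p (up f))
  end.

Lemma sat_fren (M : structure L) n (phi : formula L n) m (f : 'I_n -> 'I_m)
    (v : 'I_m -> M) : sat (fren phi f) v <-> sat phi (v \o f).
Proof.
elim: phi m f v => [k|k t u|k r ts|k p IHp p' IHp'|k p IHp] m f v //=.
- by rewrite !eval_tren.
- suff -> : (fun k0 => eval v (tren f (ts k0))) =
            (fun k0 => eval (v \o f) (ts k0)) by [].
  by apply/funext => l; rewrite eval_tren.
- by rewrite IHp IHp'.
- by split=> H x; move: (H x); rewrite IHp scons_up.
Qed.

End Renaming.

(** * Elementary embeddings and algebraic closure *)

Section ElementaryEmbeddings.
Variables (L : language) (N M : structure L) (i : N -> M).
Hypothesis hi : elementary i.

Lemma elementary_inj : injective i.
Proof.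
move=> x y xy; pose v : 'I_2 -> N := tnth [tuple x; y].
by have /= := hi (Eq (Var L (ord0 : 'I_2)) (Var L ord_max)) v => -> /=.
Qed.

Lemma elementary_hom : hom i.
Proof.
move=> f u; pose v := scons (aop N f u) u.
have /hi /= : sat (Eq (Var L ord0) (App (fun k => Var L (lift ord0 k)))) v.
  rewrite /= /v scons0; congr aop; apply/funext => k; by rewrite scons_lift.
rewrite /v scons0 => ->; congr aop; apply/funext => k; by rewrite scons_lift.
Qed.

Lemma elementary_models (T : theory L) : models N T -> models M T.
Proof.
move=> hN phi Tphi v; have v0 : 'I_0 -> N by case.
suff -> : v = i \o v0 by apply/hi; exact: hN.
by apply/funext => -[].
Qed.

(* Tarski-Vaught test for [phi] together with finitely many [x <> w]. *)
Lemma definable_avoid (s : seq {classic N}) n (phi : formula L n.+1)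
    (v : 'I_n -> N) (c : M) :
  definable phi (i \o v) c -> (forall w, w \in s -> c <> i w) ->
  exists2 x : {classic N}, definable phi v x & x \notin s.
Proof.
elim: s n phi v => [|w s IH] n phi v phic cs.
  (* Otherwise [N] satisfies that [phi] has no solution, and elementarity contradicts the solution
     [c] in [M]. *)
  apply: contrapT => H.
  have /hi : sat (All (Imp phi (Bot L n.+1))) v by move=> x /= ?; apply: H; exists x.
  by move=> /(_ c); apply.
(* The conjunction of [phi] and x <> z, written with [Imp] and [Bot]; z is a new first parameter,
   past which [up (lift ord0)] shifts the old ones. *)
pose phi' : formula L n.+2 :=
  Imp (Imp (fren phi (up (lift ord0)))
           (Eq (Var L ord0) (Var L (lift ord0 ord0)))) (Bot L n.+2).
have phi'P (K : structure L) (u : 'I_n -> K) (z x : K) :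
    definable phi' (scons z u) x <-> definable phi u x /\ x <> z.
  rewrite /definable /phi' /= sat_fren scons_up scons_lift !scons0.
  have -> : scons z u \o lift ord0 = u by apply/funext => k /=; rewrite scons_lift.
  by split=> [/not_implyP//|[phix xz] /(_ phix)].
have [||x /phi'P[phix xw] xs] := IH _ phi' (scons w v).
- rewrite comp_scons phi'P; split=> //.
  by apply: cs; rewrite mem_head.
- by move=> z zs; apply: cs; rewrite in_cons zs orbT.
- by exists x => //; rewrite in_cons negb_or xs andbT; exact/eqP.
Qed.

(** A solution outside [N] avoids the finitely many solutions in [N], so [definable_avoid] would
    give yet another one in [N]. *)
Lemma acl_elementary (A : set M) : A `<=` range i -> acl A `<=` range i.
Proof.
move=> Ai c [n [phi [u [uA fin phic]]]]; apply: contrapT => Nc.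
have /choice[v vu] : forall k, exists x, i x = u k.
  by move=> k; have [x _ <-] := Ai _ (uA k); exists x.
have {vu uA}uE : u = i \o v by apply/funext => k /=; rewrite vu.
rewrite uE in fin phic.
(* The injective map [i] sends the solutions in [N] into the finite solution set in [M]. *)
have /finite_seqP[s sP] : finite_set (definable phi v : set {classic N}).
  apply: sub_finite_set (finite_preimage _ fin); last first.
    by move=> ? ? _ _; exact: elementary_inj.
  move=> x /=; rewrite /definable /= hi.
  suff -> : (fun k => i (scons x v k)) = scons (i x) (i \o v) by [].
  exact: comp_scons.
have [|x] := @definable_avoid s n phi v c phic.
  by move=> w _ cw; apply: Nc; exists w.
by rewrite sP /= => ->.
Qed.

End ElementaryEmbeddings.

(** * Generated subalgebras and their cardinality *)

Lemma card_II_sub_eq T (A B : set T) n :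
  A `<=` B -> A #= `I_n -> B #= `I_n -> A = B.
Proof.
move=> AB An Bn; pose A' : set {classic T} := A; pose B' : set {classic T} := B.
have fA : finite_set A' by apply/finite_setP; exists n.
have fB : finite_set B' by apply/finite_setP; exists n.
apply: (fset_set_inj fA fB); apply/eqP.
have sAB : (fset_set A' `<=` fset_set B')%fset by rewrite -fset_set_sub.
by rewrite eqEfcard sAB (card_fset_set (An : A' #= _)) (card_fset_set (Bn : B' #= _)) /=.
Qed.

Section Generation.
Variables (S : signature) (A B : algebra S).

Lemma gen_sub (X Y : set A) : X `<=` gen Y -> gen X `<=` gen Y.
Proof. by move=> XY x; elim=> [y /XY//|f u _ IH]; exact: gen_op. Qed.

Lemma card_gen_alg (X : set A) n :
  [set: gen_alg X] #= `I_n -> gen X #= `I_n.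
Proof.
apply: card_eq_trans.
have -> : gen X = [set sval x | x in [set: gen_alg X]].
  apply/seteqP; split=> [x gx|_ [x _ <-]]; last exact: svalP.
  by exists (exist _ x gx).
by apply: inj_card_eq => -[x gx] [y gy] _ _ /= xy; exact: eq_exist.
Qed.

Lemma hom_gen_eq (h h' : A -> B) (X : set A) : hom h -> hom h' ->
  (forall x, X x -> h x = h' x) -> forall x, gen X x -> h x = h' x.
Proof.
move=> hh hh' XE x; elim=> [y /XE//|f u _ IH].
by rewrite hh hh'; congr aop; apply/funext.
Qed.

End Generation.

Lemma hom_mul (A B : algebra star_sig) (h : A -> B) (x y : A) :
  hom h -> h (mul x y) = mul (h x) (h y).
Proof.
move=> hh; rewrite /mul hh; congr aop; apply/funext => k.
by case: k => -[|[|//]] lt; rewrite !(tnth_nth x) !(tnth_nth (h x)).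
Qed.

Lemma gen_mul (A : algebra star_sig) (X : set A) (x y : A) :
  gen X x -> gen X y -> gen X (mul x y).
Proof.
move=> Xx Xy; apply: gen_op => k.
by case: k => -[|[|//]] lt; rewrite (tnth_nth x).
Qed.

(** * Lines and idempotence in a (2,q)-variety *)

Section TwoQVarieties.
Variables (V : algebra star_sig -> Prop) (q : nat).
Hypothesis hV : two_q_variety V q.

(** One line is included in the other and both have [q] points. *)
Lemma line_eq (A : algebra star_sig) (x y u v : A) : V A -> x <> y -> u <> v ->
  line x y u -> line x y v -> line u v = line x y.
Proof.
move=> VA xy uv lu lv; have [_ card] := hV.
apply: (@card_II_sub_eq _ _ _ q).
- by apply: gen_sub => _ [->|->].
- by apply: card_gen_alg; have [] := card _ VA u v uv.
- by apply: card_gen_alg; have [] := card _ VA x y xy.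
Qed.

(* If [s * s <> s] in the free algebra on [s, t], then [s] alone generates the
   [q]-element line through [s] and [s * s], which is the whole algebra; so
   homomorphisms to [A] cannot choose the value at [t] freely. *)
Lemma mul_idem (A : algebra star_sig) (x y : A) : card_F2 V q ->
  V A -> x <> y -> forall z : A, mul z z = z.
Proof.
move=> [F [[s [t [VF free]]] cardF]] VA xy z.
suff ss : mul s s = s.
  have [h [[hh [hs _]] _]] := free A VA z z.
  by rewrite -hs -hom_mul // ss.
apply: contrapT => ss.
have lineT : line s (mul s s) = setT.
  apply: (@card_II_sub_eq _ _ _ q) => //; apply: card_gen_alg.
  by have [] := hV.2 F VF s (mul s s) (fun e => ss (esym e)).
have genT : gen [set s] t.
  have : line s (mul s s) t by rewrite lineT.
  apply: gen_sub => u; have gs : gen [set s] s by exact: gen_in.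
  by case=> ->//; exact: gen_mul.
have [h [[hh [hs ht]] _]] := free A VA x y.
have [h' [[hh' [hs' ht']] _]] := free A VA x x.
apply: xy; rewrite -ht' -ht; apply: hom_gen_eq hh' hh _ _ genT.
by move=> _ ->; rewrite hs hs'.
Qed.

End TwoQVarieties.

(** * Covering [M] by fans *)

Section Fans.
Variables (V : algebra star_sig -> Prop) (q : nat) (T : theory star_lang).
Hypothesis hT : steiner_theory V q T.
Variables (N M : structure star_lang) (i : N -> M).
Hypotheses (hN : models N T) (hi : elementary i).
Variables (a b : N).
Hypothesis ab : a <> b.

Let hM : models M T := elementary_models hi hN.

(** The equation is already solvable in [N], and its solution in [M] is unique. *)
Lemma range_mul_inv (c : N) (x : M) : range i (mul (i c) x) -> range i x.
Proof.
move=> [y _ yE]; have [[z [zE _]] _] := st_quasigroup hT hN c y.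
have [[w [_ uniq]] _] := st_quasigroup hT hM (i c) (i y).
exists z => //; rewrite -(uniq x) ?yE //; apply/esym/uniq.
by rewrite -hom_mul ?zE //; exact: (elementary_hom hi).
Qed.

Lemma line_mul (c : N) (x : M) : ~ range i x ->
  line x (mul (i c) x) = line (i c) x.
Proof.
move=> Nx; have VM := st_variety hT hM.
have [V2 _ _] := st_mikado hT.
have cx : i c <> x by move=> cx; apply: Nx; exists c.
have iab : i a <> i b by move/(elementary_inj hi).
have lc : line (i c) x (i c) by apply: gen_in; left.
have lx : line (i c) x x by apply: gen_in; right.
apply: (line_eq V2) => //; last exact: gen_mul.
(* If [x = mul (i c) x], then idempotence and right cancellation give [i c = x]. *)
move=> xE; have [_ [y [_ uniq]]] := st_quasigroup hT hM x x.
apply: cx; rewrite -(uniq (i c)) ?(uniq x) //.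
exact: (mul_idem V2 (st_card_F2 hT) VM iab).
Qed.

Lemma mem_fan (d : M) : ~ range i d -> fan (i a) (i b) d d.
Proof.
move=> Nd; have VM := st_variety hT hM; have [V2 _ _] := st_mikado hT.
pose e := mul (i a) d.
have Ne : ~ range i e by move=> /range_mul_inv.
have NE (c : N) x : ~ range i x -> i c <> x by move=> Nx cx; apply: Nx; exists c.
exists 0%N => //; exists (Path (i a) (i b) e).
- split.
    (* Legality: the algebraic closure of [i a] and [i b] stays inside [range i], which omits
       [e]. *)
    split=> /=; first by move/(elementary_inj hi).
    by move/(acl_elementary hi) => H; apply: Ne; apply: H => _ [->|->]; eexists.
  left; exists e => //; exists (line e (mul (i b) e)); last by apply: gen_in; left.
  split; first by rewrite line_mul //; apply: gen_in; left.
  (* The second line has index 1; the path cannot stop at index 0, where no earlier line exists. *)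
  by exists 1%N => // k; rewrite ltnS leqn0 => /eqP -> [].
- exists 0%N; split=> //=; try by move/esym; exact: NE.
  rewrite /path_line /= line_mul // (line_eq V2 (x := i a) (y := d)) //.
  + by apply: gen_in; right.
  + exact: NE.
  + exact: NE.
  + by apply: gen_in; left.
  + by apply: gen_mul; apply: gen_in; [left|right].
Qed.

Lemma fans_cover :
  [set: M] = range i `|` \bigcup_(d in ~` range i) fan (i a) (i b) d.
Proof.
apply/seteqP; split=> // x _; have [|Nx] := pselect (range i x); first by left.
by right; exists x => //; exact: mem_fan.
Qed.

End Fans.

Theorem theorem4p3p5 (V : algebra star_sig -> Prop) (q : nat)
    (T : theory star_lang) (hT : steiner_theory V q T)
    (N M : structure star_lang) (hN : models N T) (hM : models M T)
    (i : N -> M) (hi : elementary i)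
    (hcount : countable [set: M]) (hdim : dim1 i) :
  (forall a b : N, a <> b ->
     exists D : set M, D `<=` ~` range i /\
       [set: M] = range i `|` \bigcup_(d in D) fan (i a) (i b) d) /\
  (forall (M' : structure star_lang) (j : M -> M'), elementary j ->
     forall a b : N, a <> b ->
     exists D : set M', D `<=` ~` range (j \o i) /\
       [set: M'] = range (j \o i) `|`
                   \bigcup_(d in D) fan (j (i a)) (j (i b)) d).
Proof.
split=> [a b ab|M' j hj a b ab].
  by exists (~` range i); split=> //; exact: (fans_cover hT).
exists (~` range (j \o i)); split=> //.
(* Elementary maps compose, so the covering result applies directly to [N] inside [M']. *)
have hji : elementary (j \o i) by move=> n phi v; rewrite hi hj.
exact: (fans_cover hT hN hji ab).
Qed.
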